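(* Every group which is an S-loop is a GS-loop.
   Context: A loop is a set $L$ with a binary operation $\cdot$ such that each of the equations $a\cdot x=b$ and $y\cdot a=b$ has a unique solution, and with a two-sided identity element. An S-loop is a loop $(L,\cdot)$ having at least one non-trivial subset $M\subset L$ (a proper subset with more than one element) such that $(M,\cdot)$ is a group; such an $M$ is called an S-subgroup. Maps are written on the right. An isotopism $(U,V,W):(L,\cdot)\to(K,\circ)$ is a triple of bijections $L\to K$ with $xU\circ yV=(x\cdot y)W$ for all $x,y\in L$; if $(K,\circ)$ is a loop, it is called a loop isotope of $(L,\cdot)$. S-loops $(L,\cdot)$ and $(K,\circ)$ are S-isomorphic if there are S-subgroups $L'\subset L$, $K'\subset K$ and an isomorphism $U:(L,\cdot)\to(K,\circ)$ with $(L')U=K'$. An S-loop $(L,\cdot)$ is a G-Smarandache loop (GS-loop) if it is S-isomorphic to all of its loop isotopes $(K,\circ)$ (or, in particular, to all of its S-loop isotopes). *)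

(* Defs.v *)
From mathcomp Require Import all_boot monoid.
From mathcomp Require Import classical_sets.

Set Implicit Arguments.
Unset Strict Implicit.
Unset Printing Implicit Defensive.

Local Open Scope classical_set_scope.
Local Open Scope group_scope.

(* [magmaType] is the bare "set with a binary operation": it assumes no law,
   and its carrier is an arbitrary type, not even a [choiceType] (as would be
   the case for [groupType]). *)

Definition is_loop (L : magmaType) : Prop :=
  [/\ forall a b : L, exists! x, a * x = b,
      forall a b : L, exists! y, y * a = b &
      exists e : L, left_id e mul /\ right_id e mul].

(* The identity and inverses are those of [M] itself: [e] is not assumed to be
   an identity of the ambient [L]. *)
Definition is_group_on (L : magmaType) (M : set L) : Prop :=
  [/\ forall x y, M x -> M y -> M (x * y),
      forall x y z, M x -> M y -> M z -> x * (y * z) = x * y * z &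
      exists e, [/\ M e,
        forall x, M x -> e * x = x /\ x * e = x &
        forall x, M x -> exists y, [/\ M y, y * x = e & x * y = e]]].

Definition is_group (L : magmaType) : Prop := is_group_on [set: L].

Definition S_subgroup (L : magmaType) (M : set L) : Prop :=
  [/\ M `<` [set: L], exists x y, [/\ M x, M y & x <> y] & is_group_on M].

Definition S_loop (L : magmaType) : Prop :=
  is_loop L /\ exists M : set L, S_subgroup M.

Definition isotopism (L K : magmaType) (U V W : L -> K) : Prop :=
  [/\ bijective U, bijective V, bijective W &
      forall x y : L, U x * V y = W (x * y)].

Definition loop_isotope (L K : magmaType) : Prop :=
  is_loop K /\ exists U V W : L -> K, isotopism U V W.

Definition isomorphism (L K : magmaType) (U : L -> K) : Prop :=
  bijective U /\ {morph U : x y / x * y}.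

Definition S_isomorphic (L K : magmaType) : Prop :=
  [/\ S_loop L, S_loop K &
      exists (L' : set L) (K' : set K) (U : L -> K),
        [/\ S_subgroup L', S_subgroup K', isomorphism U & U @` L' = K']].

(* Every loop isotope [K] is considered, not only those already known to be
   S-loops; that [K] is an S-loop is part of [S_isomorphic L K]. *)
Definition GS_loop (L : magmaType) : Prop :=
  S_loop L /\ forall K : magmaType, loop_isotope L K -> S_isomorphic L K.

(* Main.v *)
Require Import Defs.
From mathcomp Require Import all_boot monoid.
From mathcomp Require Import classical_sets.

(** The reason is Albert's theorem: a loop isotopic to a group is isomorphic to
    it.  Let [(U, V, W)] be an isotopism from the group [L] to a loop [K] with
    identity [e], and choose [a], [b] with [U a = V b = e].  Evaluating the
    isotopism at [a] on the left and at [b] on the right expresses [U] and [V]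
    by [W], namely [V y = W (a * y)] and [U x = W (x * b)].  The operation of
    [K] thereby becomes that of [L] twisted by one constant, which associativity
    absorbs into a translation: [x |-> V (b * x)] is an isomorphism
    ([group_isotope_isomorphic]).  An isomorphism carries an S-subgroup of [L]
    to one of [K] ([S_subgroup_image]), so every loop isotope of [L] is an
    S-loop that is S-isomorphic to [L]. *)

Local Open Scope classical_set_scope.
Local Open Scope group_scope.

Lemma is_group_on_image (L K : magmaType) (T : L -> K) (M : set L) :
  {morph T : x y / x * y} -> is_group_on M -> is_group_on (T @` M).
Proof.
move=> TM [Mmul MA [e [Me Mid Minv]]]; split.
- by move=> _ _ [x Mx <-] [y My <-]; rewrite -TM; exists (x * y) => //; exact: Mmul.
- move=> _ _ _ [x Mx <-] [y My <-] [z Mz <-].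
  by rewrite -!TM MA.
- exists (T e); split; first by exists e.
  + by move=> _ [x Mx <-]; rewrite -!TM; have [-> ->] := Mid x Mx.
  + move=> _ [x Mx <-]; have [y [My yx xy]] := Minv x Mx.
    by exists (T y); split; [exists y | rewrite -TM yx | rewrite -TM xy].
Qed.

Lemma S_subgroup_image (L K : magmaType) (T : L -> K) (M : set L) :
  isomorphism T -> S_subgroup M -> S_subgroup (T @` M).
Proof.
move=> [Tbij TM] [[_ Mproper] [x [y [Mx My xy]]] Mgrp].
have Tinj := bij_inj Tbij; split; last exact: is_group_on_image.
- split=> // full; apply: Mproper => z _.
  by have [t Mt /Tinj <-] := full (T z) I.
- exists (T x), (T y); split; [by exists x | by exists y |].
  by move=> /Tinj.
Qed.

Lemma group_translation_bij (L : magmaType) (b : L) :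
  is_group L -> bijective (fun x => b * x).
Proof.
move=> [_ assoc [e [_ eP inv]]]; have [c [_ cb bc]] := inv b I.
by exists (fun x => c * x) => x; rewrite assoc // ?cb ?bc; have [] := eP x I.
Qed.

(** Albert's theorem.  With [c] the inverse of [b] one has
    [V (b * x) = W (a * b * x) = U (a * b * x * c)], so the isotopism applies to
    the product of [V (b * x)] and [V (b * y)], where [c] and [b] cancel. *)
Lemma group_isotope_isomorphic (L K : magmaType) :
  is_group L -> loop_isotope L K -> exists T : L -> K, isomorphism T.
Proof.
move=> Lgrp [[_ _ [e [e1 e2]]] [U [V [W [[U' _ UK] Vbij _ UVW]]]]].
have [V' _ VK] := Vbij.
pose a := U' e; pose b := V' e.
have VW y : V y = W (a * y) by rewrite -UVW UK e1.
have UW x : U x = W (x * b) by rewrite -UVW VK e2.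
exists (fun x => V (b * x)); split.
  exact: bij_comp Vbij (group_translation_bij L b Lgrp).
have [_ assoc [i [_ iP inv]]] := Lgrp.
have mulA x y z : x * (y * z) = x * y * z :> L by exact: assoc.
have [c [_ cb _]] := inv b I.
move=> x y /=.
have -> : V (b * x) = U (a * b * x * c).
  by rewrite UW VW -!mulA cb; have [_ ->] := iP x I.
rewrite UVW VW; congr W; rewrite -!mulA (mulA c b y) cb.
by have [-> _] := iP y I.
Qed.

Theorem corollary5p1 (L : magmaType) (hgroup : is_group L) (hS : S_loop L) :
  GS_loop L.
Proof.
split=> // K isoLK.
have [Kloop _] := isoLK; have [_ [M MS]] := hS.
have [T Tiso] := group_isotope_isomorphic L K hgroup isoLK.
have TMS := S_subgroup_image L K T M Tiso MS.
split=> //; first by split=> //; exists (T @` M).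
by exists M, (T @` M), T.
Qed.
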